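(* Let $n \in \mathbb{N}$ and $0 < \alpha \le 1$. Then there exists a constant $c = c(n,\alpha) > 0$, depending only on $n$ and $\alpha$, such that for every measure $\mu$ on $\mathbb{R}^n$ we have $$\limsup_{r \downarrow 0} \inf_{\theta \in S^{n-1}} \frac{\mu\bigl( B(x,r) \setminus H(x,\theta,\alpha) \bigr)}{\mu\bigl( B(x,r) \bigr)} > c$$ for $\mu$-almost every $x \in \mathbb{R}^n$.
   Context: A measure on $\mathbb{R}^n$ always means a finite, nontrivial (not identically zero) Borel regular outer measure defined on all subsets of $\mathbb{R}^n$. $B(x,r)$ is the closed ball with centre $x$ and radius $r>0$, and $S^{n-1}$ is the unit sphere of $\mathbb{R}^n$. For $x \in \mathbb{R}^n$, $\theta \in S^{n-1}$ and $0 \le \alpha \le 1$, $$H(x,\theta,\alpha) = \{ y \in \mathbb{R}^n : (y-x)\cdot\theta > \alpha |y-x| \}.$$ *)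

(* Defs.v *)
From mathcomp Require Import all_boot all_order all_algebra.
From mathcomp Require Import all_classical all_reals all_analysis.
Import Order.TTheory GRing.Theory Num.Theory.
Import numFieldNormedType.Exports.

Set Implicit Arguments.
Unset Strict Implicit.
Unset Printing Implicit Defensive.

Local Open Scope classical_set_scope.
Local Open Scope ring_scope.

Section Euclidean.
Context {R : realType} {n : nat}.
Implicit Types (x y theta : 'rV[R]_n) (r alpha : R).

Definition dot x y : R := \sum_(i < n) x ord0 i * y ord0 i.

(* The library norm on ['rV[R]_n] is the sup norm, hence a separate
   Euclidean norm; both induce the topology used for [open] below. *)
Definition enorm x : R := Num.sqrt (dot x x).

Definition eball x r : set 'rV[R]_n := [set y | enorm (y - x) <= r].

Definition esphere : set 'rV[R]_n := [set theta | enorm theta = 1].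

Definition cone x theta alpha : set 'rV[R]_n :=
  [set y | alpha * enorm (y - x) < dot (y - x) theta].

Definition borel : set (set 'rV[R]_n) := <<s open >>.

End Euclidean.

Local Open Scope ereal_scope.

Definition borel_regular (R : realType) (n : nat)
    (mu : {outer_measure set 'rV[R]_n -> \bar R}) : Prop :=
  (forall B, borel B -> mu.-caratheodory B) /\
  (forall A, exists B, [/\ borel B, A `<=` B & mu B = mu A]).

(* For an outer measure, almost everywhere means that the exceptional set,
   measurable or not, is null. *)
Definition outer_ae (T : Type) (R : realType)
    (mu : {outer_measure set T -> \bar R}) (P : T -> Prop) : Prop :=
  mu [set x | ~ P x] = 0.

(* Main.v *)
Require Import Defs.
From mathcomp Require Import all_boot all_order all_algebra.
From mathcomp Require Import all_classical all_reals all_analysis.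
From mathcomp Require Import ring lra zify.
Import Order.TTheory GRing.Theory Num.Theory.
Import numFieldNormedType.Exports.
Local Open Scope classical_set_scope.
Local Open Scope ring_scope.
Local Open Scope ereal_scope.

(** At a point x where the limsup is small there is, for every small radius r,
    a direction theta such that all but a small proportion of the mass of
    B(x,r) lies in the cone H(x,theta,alpha). Replace theta by an integer
    vector w close to K theta, where K >= n / alpha: since alpha > 0, the cone
    is still contained in the open half-space of the y with y.w > x.w
    ([cone_sub_integer_halfspace]), and only finitely many vectors w occur, N
    of them say. So x lies very low for some linear function y |-> y.w: the
    part of B(x,r) that is not above x has tiny mass.

    Points that are low in this sense are rare. For one function f and one set
    Q, the points x of Q such that Q /\ {f <= f x} has mass at most kappa have
    together mass at most kappa ([low_sublevel_small]): up to a countable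
    increasing union, they all lie in one such sublevel set.

    To use this, cut the space into cubes Q of side s, a grid so fine that
    n s is one of the admissible radii. For x in Q, the ball B(x, n s)
    contains Q and is covered by the D = (2n+1)^n cubes around Q. So the bad
    points of Q have mass at most N c times the mass of these D cubes
    ([tilted_cell_le]). Each cube is counted D times in the sum over Q, hence
    bad points have total mass at most N c D times that of the space: a single
    cube may carry much less mass than the cubes around it, but this imbalance
    disappears in the sum over the grid.

    The same count inside an open set U containing the set A of bad points
    gives mu A <= N c D mu U, up to the points of U close to its boundary,
    whose mass vanishes with s ([tilted_core_le], [core_set_exhausts]). By
    outer regularity ([outer_regular]) mu U can be taken arbitrarily close to
    mu A. With c = 1 / (2 N D) this says mu A <= mu A / 2, whence mu A = 0. *)

Set Implicit Arguments.
Unset Strict Implicit.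
Unset Printing Implicit Defensive.

(** * Outer regularity of finite Borel measures *)

Lemma small_of_decreasing (R : realType) (T : pointedType)
    (mu : {outer_measure set T -> \bar R}) (F : (set T)^nat) (e : R) :
  mu setT < +oo -> (forall k, mu.-caratheodory (F k)) ->
  nonincreasing_seq F -> \bigcap_k F k = set0 -> (0 < e)%R ->
  exists k, mu (F k) < e%:E.
Proof.
move=> mufin mF dF F0 e0.
have F0fin : mu (F 0%N) < +oo by apply: le_lt_trans mufin; exact: le_outer_measure.
have mcap : mu.-cara.-measurable (\bigcap_k F k) by rewrite F0; exact: measurable0.
have cvF : mu (F k) @[k --> \oo] --> (0 : \bar R).
  rewrite -(outer_measure0 mu) -F0.
  exact: (@nonincreasing_cvg_mu _ (caratheodory_type mu) R mu F F0fin mF mcap dF).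
have nb : nbhs (0 : \bar R) [set x | x < e%:E].
  by apply: open_nbhs_nbhs; split; [exact: open_ereal_lt_ereal|rewrite /= lte_fin].
have [N _ NF] := cvF _ nb; exists N; exact: NF (leqnn N).
Qed.

(** The points of [U] at distance at least [rho] from its complement, written
    with balls so that its complement is visibly a union of open balls. *)
Definition core_set (R : realType) (V : normedModType R) (U : set V) (rho : R) : set V :=
  [set x | ball x rho `<=` U].

Lemma open_setC_core_set (R : realType) (V : normedModType R) (U : set V) (rho : R) :
  open (~` core_set U rho).
Proof.
have -> : ~` core_set U rho = \bigcup_(y in ~` U) ball y rho.
  apply/seteqP; split=> x /=.
    by move=> /existsNP[y /not_implyP[xy Uy]]; exists y => //; exact: ball_sym.
  by move=> [y Uy xy] /(_ y (ball_sym xy)).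
by apply: bigcup_open => y _; exact: ball_open.
Qed.

Lemma core_set_le (R : realType) (V : normedModType R) (U : set V) (r s : R) :
  (r <= s)%R -> core_set U s `<=` core_set U r.
Proof. by move=> rs x; apply: subset_trans; exact: le_ball. Qed.

(** Every point of an open set has a ball inside the set, so the differences
    [U `\` core_set U (1 / (k + 1))] decrease to the empty set. *)
Lemma core_set_exhausts (R : realType) (V : normedModType R)
    (mu : {outer_measure set V -> \bar R}) (U : set V) (e : R) :
  (forall W, open W -> mu.-caratheodory W) -> mu setT < +oo ->
  open U -> (0 < e)%R ->
  exists2 rho : R, (0 < rho)%R & mu (U `\` core_set U rho) < e%:E.
Proof.
move=> mo mufin oU e0.
suff [k Hk] : exists k, mu (U `\` core_set U k.+1%:R^-1) < e%:E by exists k.+1%:R^-1%R.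
apply: small_of_decreasing => //.
- by move=> k; rewrite setDE; apply: caratheodory_measurable_setI; apply: mo => //;
     exact: open_setC_core_set.
- move=> k l kl; apply/subsetPset; apply: setDS; apply: core_set_le.
  by rewrite lef_pV2 ?posrE// ler_nat.
- apply/seteqP; split=> // x xI.
  have Ux : U x by case: (xI 0%N).
  have /nbhs_ballP[r /= r0 rU] : nbhs x U by exact: open_nbhs_nbhs.
  have [k _ /(_ k (leqnn k)) kr] := near_infty_natSinv_lt (PosNum r0).
  case: (xI k I) => _; apply; apply: subset_trans rU.
  by apply: le_ball; exact: ltW.
Qed.

(** Two-sided approximation, [~` W `<=` B `<=` U] with [U] and [W] open. The
    inner closed set enters through its complement [W], which makes the
    condition symmetric in [B] and [~` B]. *)
Definition open_approx (R : realType) (V : normedModType R)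
    (mu : set V -> \bar R) (B : set V) : Prop :=
  forall e : R, (0 < e)%R -> exists U W,
    [/\ open U, open W, B `<=` U, ~` B `<=` W & mu (U `&` W) <= e%:E].

(** The approximable sets form a sigma-algebra, and an open set is approximable
    because its cores are closed and exhaust it. For a countable union, the
    intersection of all the [W]s need not be open, so only finitely many are
    intersected; finiteness of [mu] makes the remainder small. *)
Lemma borel_open_approx (R : realType) (V : normedModType R)
    (mu : {outer_measure set V -> \bar R}) :
  (forall W, open W -> mu.-caratheodory W) -> mu setT < +oo ->
  <<s open >> `<=` open_approx mu.
Proof.
move=> mo mufin; apply: smallest_sub; last first.
  move=> U oU e e0; have [rho rho0 Hrho] := core_set_exhausts mo mufin oU e0.
  exists U, (~` core_set U rho); split=> //.
  - exact: open_setC_core_set.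
  - by move=> x Ux /(_ x (ballxx _ rho0)).
  - exact: ltW.
split.
- move=> e e0; exists set0, setT; split=> //.
  + exact: open0.
  + exact: openT.
  + by rewrite set0I outer_measure0 lee_fin ltW.
- move=> B + e e0 => /(_ e e0)[U [W [oU oW BU BW UW]]]; exists W, U; split=> //.
  + by move=> x [_]; exact: BW.
  + by rewrite setTD setCK.
  + by rewrite setIC.
move=> B HB e e0.
have e20 k : (0 < (e / 2) / (2 ^ k.+1)%:R)%R by rewrite !divr_gt0// ltr0n expn_gt0.
have /choice[f Hf] k : exists p : set V * set V,
    [/\ open p.1, open p.2, B k `<=` p.1, ~` B k `<=` p.2 &
        mu (p.1 `&` p.2) <= ((e / 2) / (2 ^ k.+1)%:R)%:E].
  by have [U [W H]] := HB k _ (e20 k); exists (U, W).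
pose U := \bigcup_k (f k).1.
have oU : open U by apply: bigcup_open => k _; case: (Hf k).
pose init k := \big[setU/set0]_(i < k) (f i).1.
have oinit k : open (init k).
  rewrite /init -(bigcup_mkord _ (fun i => (f i).1)).
  by apply: bigcup_open => i _; case: (Hf i).
have e2 : (0 < e / 2)%R by rewrite divr_gt0.
(* [N] is where the intersection of the second components is cut off. *)
have [N HN] : exists k, mu (U `\` init k) < (e / 2)%:E.
  apply: small_of_decreasing => //.
  - move=> k; rewrite setDE; apply: caratheodory_measurable_setI; first exact: mo.
    by apply: caratheodory_measurable_setC; exact: mo.
  - by move=> k l kl; apply/subsetPset; apply: setDS;
     exact: (@subset_bigsetU _ (fun i => (f i).1)).
  - apply/seteqP; split=> // x xI.
    have [[k _ fkx] _] := xI 0%N I.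
    have [_] := xI k.+1 I; apply.
    by rewrite /init big_ord_recr/=; right.
exists U, (\big[setI/setT]_(i < N) (f i).2); split=> //.
- by apply: big_ind => [|A C oA oC|i _]; [exact: openT|exact: openI|case: (Hf i)].
- by move=> x [k _ Bx]; exists k => //; case: (Hf k) => _ _ + _ _; exact.
- move=> x Bx; rewrite -(bigcap_mkord _ (fun i => (f i).2)) => i _.
  case: (Hf i) => _ _ _ + _; apply.
  by move=> Bix; apply: Bx; exists i.
- have sub : U `&` \big[setI/setT]_(i < N) (f i).2 `<=`
      \bigcup_k ((f k).1 `&` (f k).2) `|` (U `\` init N).
    move=> x [Ux]; rewrite -(bigcap_mkord _ (fun i => (f i).2)) => fx.
    have [hx|hx] := pselect (init N x); last by right.
    left; move: hx; rewrite /init -(bigcup_mkord _ (fun i => (f i).1)) => -[k /= kN fkx].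
    by exists k => //; split=> //; exact: fx.
  apply: le_trans (le_outer_measure mu _ _ sub) _.
  apply: le_trans (outer_measureU2 _ _ _) _.
  rewrite [e]splitr EFinD; apply: leeD (ltW HN).
  apply: le_trans (outer_measure_sigma_subadditive mu _) _.
  apply: le_trans (epsilon_trick0 xpredT (ltW e2)).
  apply: lee_nneseries => [k _ _|k _]; first exact: outer_measure_ge0.
  by case: (Hf k).
Qed.

Lemma outer_regular (R : realType) (V : normedModType R)
    (mu : {outer_measure set V -> \bar R}) (A : set V) (e : R) :
  (forall W, open W -> mu.-caratheodory W) -> mu setT < +oo ->
  (exists B, [/\ <<s open >> B, A `<=` B & mu B = mu A]) -> (0 < e)%R ->
  exists U, [/\ open U, A `<=` U & mu U <= mu A + e%:E].
Proof.
move=> mo mufin [B [bB AB <-]] e0.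
have [U [W [oU oW BU BW UW]]] := borel_open_approx mo mufin bB e0.
exists U; split=> //; first exact: subset_trans AB BU.
have sub : U `<=` B `|` (U `&` W).
  by move=> x Ux; have [Bx|Bx] := pselect (B x); [left|right; split=> //; exact: BW].
apply: le_trans (le_outer_measure mu _ _ sub) _.
by apply: le_trans (outer_measureU2 _ _ _) _; exact: leeD2l.
Qed.

(** * Points that are low for a real function *)

Lemma mu_nondecreasing_bigcup_le (R : realType) (T : pointedType)
    (mu : {outer_measure set T -> \bar R}) (E : (set T)^nat) (kappa : \bar R) :
  (forall k, mu.-caratheodory (E k)) -> nondecreasing_seq E ->
  (forall k, mu (E k) <= kappa) -> mu (\bigcup_k E k) <= kappa.
Proof.
move=> mE ndE Ek.
have mcup : mu.-cara.-measurable (\bigcup_k E k).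
  exact: (@bigcupT_measurable _ (caratheodory_type mu)).
have cvE := @nondecreasing_cvg_mu _ (caratheodory_type mu) R mu E mE mcup ndE.
by apply: cvge_le cvE; exact: nearW.
Qed.

(** If [f] attains its maximum over the set [S] of low points, then [S] lies in
    the sublevel set of a single low point. Otherwise [S] is an increasing union
    of parts that lie in sublevel sets of low points, and measures pass to the
    limit along such unions. *)
Lemma low_sublevel_small (R : realType) (T : pointedType)
    (mu : {outer_measure set T -> \bar R}) (Q : set T) (f : T -> R)
    (kappa : \bar R) :
  (forall t : R, mu.-caratheodory (Q `&` [set y | (f y <= t)%R])) ->
  0 <= kappa ->
  mu [set x | Q x /\ mu (Q `&` [set y | (f y <= f x)%R]) <= kappa] <= kappa.
Proof.
move=> mQ kappa0; set S := [set x | _].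
have viaseq (b : R^nat) : nondecreasing_seq b ->
    (forall k, exists2 x, S x & (b k <= f x)%R) ->
    (forall x, S x -> exists k, (f x <= b k)%R) -> mu S <= kappa.
  move=> ndb bS Sb.
  apply: (@le_trans _ _ (mu (\bigcup_k (Q `&` [set y | (f y <= b k)%R])))).
    by apply: le_outer_measure => x Sx; have [k fxb] := Sb _ Sx; exists k => //; case: Sx.
  apply: mu_nondecreasing_bigcup_le => [k//|k l kl|k].
    by apply/subsetPset; apply: setIS => y /= /le_trans; apply; exact: ndb.
  have [x [_ Qx] bx] := bS k.
  by apply: le_trans Qx; apply: le_outer_measure; apply: setIS => y /= /le_trans; apply.
have [[x0 [Sx0 maxx0]]|nomax] :=
    pselect (exists x0, S x0 /\ forall x, S x -> (f x <= f x0)%R).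
  apply: le_trans (Sx0.2); apply: le_outer_measure => x Sx.
  by split; [case: Sx|exact: maxx0].
have {}nomax x : S x -> exists2 x', S x' & (f x < f x')%R.
  move=> Sx; apply: contrapT => nx; apply: nomax; exists x; split=> // y Sy.
  by rewrite leNgt; apply/negP => xy; apply: nx; exists y.
have [S0|/set0P[x1 Sx1]] := eqVneq S set0; first by rewrite S0 outer_measure0.
have fSne : (f @` S) !=set0 by exists (f x1), x1.
(* It remains to find levels that are cofinal in the values of [f] on [S]. *)
have [ub|nub] := pselect (has_ubound (f @` S)).
- have hs : has_sup (f @` S) by split.
  apply: (viaseq (fun k => sup (f @` S) - k.+1%:R^-1)%R).
  + move=> k l kl; rewrite lerD2l lerN2 lef_pV2 ?posrE// ler_nat//.
  + move=> k; have k0 : (0 < k.+1%:R^-1 :> R)%R by rewrite invr_gt0.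
    by have [_ [x Sx <-] lt] := sup_adherent k0 hs; exists x => //; exact: ltW.
  + move=> x Sx; have [x' Sx' xx'] := nomax _ Sx.
    have d0 : (0 < f x' - f x)%R by rewrite subr_gt0.
    have [k _ /(_ k (leqnn k)) kd] := near_infty_natSinv_lt (PosNum d0).
    exists k; have x'le : (f x' <= sup (f @` S))%R by apply: ub_le_sup => //; exists x'.
    have {}kd : (k.+1%:R^-1 < f x' - f x)%R := kd.
    by rewrite lerBrDr -lerBrDl (le_trans (ltW kd))// lerB.
- apply: (viaseq (fun k => k%:R)%R).
  + by move=> k l kl; rewrite ler_nat.
  + move=> k; apply: contrapT => nk; apply: nub; exists k%:R => _ [x Sx <-].
    by rewrite leNgt; apply/negP => kx; apply: nk; exists x => //; exact: ltW.
  + move=> x _; exists (Num.bound `|f x|%R); apply: ltW; apply: le_lt_trans (ler_norm _) _.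
    exact: archi_boundP.
Qed.

Lemma outer_measure_finU (R : realType) (T : Type) (I : finType)
    (mu : {outer_measure set T -> \bar R}) (F : I -> set T) :
  mu (\big[setU/set0]_(i : I) F i) <= \sum_(i : I) mu (F i).
Proof.
elim/big_rec2 : _ => [|i m A _ IH]; first by rewrite outer_measure0.
by apply: le_trans (outer_measureU2 _ _ _) _; exact: leeD2l.
Qed.

(** * Cones and half-spaces *)

(** Enumerates the integer vectors with entries in [-K, K] by a finite type. It
    serves twice: for directions, and for offsets between neighbouring cubes. *)
Definition box_vec (n K : nat) (v : {ffun 'I_n -> 'I_K.*2.+1}) : 'rV[int]_n :=
  (\row_i ((v i)%:Z - K%:Z))%R.

Lemma box_vec_onto (n K : nat) (w : 'rV[int]_n) :
  (forall i, (- K%:Z <= w ord0 i <= K%:Z)%R) ->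
  exists v : {ffun 'I_n -> 'I_K.*2.+1}, box_vec v = w.
Proof.
move=> wK; exists [ffun i => inord `|(w ord0 i + K%:Z)%R|%N].
apply/rowP => i; have := wK i; rewrite [ord0]ord1 => wKi.
by rewrite !mxE ffunE inordK; lia.
Qed.

Lemma coord_le_enorm (R : realType) (n : nat) (x : 'rV[R]_n) i :
  (`|x ord0 i| <= enorm x)%R.
Proof.
rewrite -sqrtr_sqr ler_sqrt; last by apply: sumr_ge0 => j _; rewrite -expr2 sqr_ge0.
rewrite /dot (bigD1 i)//= expr2 lerDl.
by apply: sumr_ge0 => j _; rewrite -expr2 sqr_ge0.
Qed.

Lemma enorm_ge0 (R : realType) (n : nat) (x : 'rV[R]_n) : (0 <= enorm x)%R.
Proof. exact: sqrtr_ge0. Qed.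

Lemma enorm_le_coord (R : realType) (n : nat) (x : 'rV[R]_n) (s : R) :
  (0 <= s)%R -> (forall i, `|x ord0 i| <= s)%R -> (enorm x <= n%:R * s)%R.
Proof.
move=> s0 xs; rewrite -[leRHS]ger0_norm ?mulr_ge0// -sqrtr_sqr ler_wsqrtr//.
apply: (@le_trans _ _ (\sum_(i < n) s ^+ 2)%R).
  apply: ler_sum => i _; rewrite -expr2 -real_normK ?num_real//.
  by rewrite ler_pXn2r// nnegrE.
rewrite sumr_const card_ord exprMn -[leLHS]mulr_natl ler_wpM2r ?sqr_ge0//.
by rewrite -natrX ler_nat; case: (n) => // m; rewrite expnS expn1 leq_pmulr.
Qed.

(** Rounding the entries of [K theta] down moves the inner product with [y - x]
    by at most [n |y - x|], while inside the cone [(y - x).(K theta)] exceeds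
    [K alpha |y - x|], which is at least [n |y - x|]. *)
Lemma cone_sub_integer_halfspace (R : realType) (n K : nat) (alpha : R)
    (theta : 'rV[R]_n) :
  esphere theta -> (n%:R <= alpha * K%:R)%R -> (0 < alpha)%R -> (0 < K)%N ->
  exists v : {ffun 'I_n -> 'I_K.*2.+1}, forall x y : 'rV[R]_n,
    cone x theta alpha y ->
    (dot x (map_mx intr (box_vec v)) < dot y (map_mx intr (box_vec v)))%R.
Proof.
move=> th aK a0 K0.
pose w : 'rV[int]_n := \row_i Num.floor (K%:R * theta ord0 i)%R.
have [v vw] : exists v : {ffun 'I_n -> 'I_K.*2.+1}, box_vec v = w.
  apply: box_vec_onto => i; rewrite mxE.
  have := coord_le_enorm theta i; rewrite th ler_norml => /andP[t1 t2].
  have k0 : (0 <= K%:R :> R)%R by [].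
  rewrite floor_ge_int rmorphN/= -mulrN1 ler_wpM2l//=.
  rewrite -(ler_int R); apply: le_trans (floor_le_tmp _) _.
  by rewrite -[leRHS]mulr1 ler_wpM2l.
exists v => x y; rewrite vw /cone /= => cy.
have dotK : (dot y (map_mx intr w) - dot x (map_mx intr w) =
    K%:R * dot (y - x) theta -
    \sum_(i < n) (y - x) ord0 i * (K%:R * theta ord0 i - (w ord0 i)%:~R))%R.
  rewrite /dot mulr_sumr -!sumrB; apply: eq_bigr => i _; rewrite !mxE; ring.
rewrite -subr_gt0 dotK subr_gt0.
apply: (@le_lt_trans _ _ (n%:R * enorm (y - x))%R).
  apply: le_trans (ler_norm _) _; apply: le_trans (ler_norm_sum _ _ _) _.
  have -> : (n%:R * enorm (y - x) = \sum_(i < n) enorm (y - x))%R.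
    by rewrite sumr_const card_ord mulr_natl.
  apply: ler_sum => i _.
  rewrite normrM -[leRHS]mulr1; apply: ler_pM => //; first exact: coord_le_enorm.
  rewrite mxE; have /andP[] := floor_itv (K%:R * theta ord0 i)%R.
  by rewrite ler_norml intrD; lra.
apply: (@le_lt_trans _ _ (K%:R * (alpha * enorm (y - x)))%R).
  by rewrite mulrA ler_wpM2r ?enorm_ge0// mulrC.
by rewrite ltr_pM2l// ltr0n.
Qed.

(** * The cubic grid *)

Definition cell (R : realType) (n : nat) (s : R) (m : 'rV[int]_n) : set 'rV[R]_n :=
  [set x | forall i, Num.floor (x ord0 i / s)%R = m ord0 i].

Lemma open_coord_lt (R : realType) (n : nat) (i : 'I_n) (a : R) :
  open [set x : 'rV[R]_n | (x ord0 i < a)%R].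
Proof.
apply: (@open_comp _ _ (fun x : 'rV[R]_n => x ord0 i) [set t | (t < a)%R]).
  by move=> x _; exact: coord_continuous.
exact: open_lt.
Qed.

Lemma continuous_dot (R : realType) (n : nat) (w : 'rV[R]_n) :
  continuous (fun y : 'rV[R]_n => dot y w).
Proof.
pose F (r : seq 'I_n) (z : 'rV[R]_n) : R := (\sum_(i <- r) z ord0 i * w ord0 i)%R.
suff contF r : continuous (F r) by exact: contF.
elim: r => [|i r IH] y.
  have -> : F [::] = cst 0%R by apply/funext => z; rewrite /F big_nil.
  exact: cst_continuous.
have -> : F (i :: r) = (fun z => z ord0 i * w ord0 i + F r z)%R.
  by apply/funext => z; rewrite /F big_cons.
by apply: cvgD (IH y); apply: cvgM; [exact: coord_continuous|exact: cvg_cst].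
Qed.

Lemma caratheodory_cell (R : realType) (n : nat)
    (mu : {outer_measure set 'rV[R]_n -> \bar R}) (s : R) (m : 'rV[int]_n) :
  (forall W, open W -> mu.-caratheodory W) -> (0 < s)%R ->
  mu.-caratheodory (cell s m).
Proof.
move=> mo s0.
have -> : cell s m = \big[setI/setT]_(i < n)
    ([set x : 'rV[R]_n | (x ord0 i < (m ord0 i + 1)%:~R * s)%R] `&`
     ~` [set x : 'rV[R]_n | (x ord0 i < (m ord0 i)%:~R * s)%R]).
  apply/seteqP; split=> x /=.
    move=> xm; rewrite -bigcap_seq => i _ /=; rewrite -(xm i).
    have /andP[h1 h2] := floor_itv (x ord0 i / s)%R.
    rewrite -ltr_pdivrMr//; split=> //; apply/negP; rewrite -leNgt.
    by rewrite -ler_pdivlMr.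
  rewrite -bigcap_seq => xm i; have /= := xm i (mem_index_enum _).
  move=> [h1 /negP]; rewrite -leNgt => h2; apply/eqP.
  by rewrite floor_eq ler_pdivlMr// ltr_pdivrMr// h1 h2.
apply: (@bigsetI_measurable _ (caratheodory_type mu)) => i _.
apply: caratheodory_measurable_setI; first by apply: mo; exact: open_coord_lt.
by apply: caratheodory_measurable_setC; apply: mo; exact: open_coord_lt.
Qed.

Lemma caratheodory_dot_le (R : realType) (n : nat)
    (mu : {outer_measure set 'rV[R]_n -> \bar R}) (w : 'rV[R]_n) (t : R) :
  (forall W, open W -> mu.-caratheodory W) ->
  mu.-caratheodory [set y | (dot y w <= t)%R].
Proof.
move=> mo.
have -> : [set y | (dot y w <= t)%R] = ~` [set y | (t < dot y w)%R].
  by apply/seteqP; split=> y /=; rewrite leNgt => /negP.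
apply: caratheodory_measurable_setC; apply: mo.
apply: (@open_comp _ _ (fun y : 'rV[R]_n => dot y w) [set r | (t < r)%R]).
  by move=> y _; exact: continuous_dot.
exact: open_gt.
Qed.

Lemma cell_bounds (R : realType) (n : nat) (s : R) (m : 'rV[int]_n) (x : 'rV[R]_n) i :
  (0 < s)%R -> cell s m x ->
  ((m ord0 i)%:~R * s <= x ord0 i < ((m ord0 i)%:~R + 1) * s)%R.
Proof.
move=> s0 xm; have := floor_itv (x ord0 i / s)%R; rewrite xm intrD.
by rewrite ler_pdivlMr// ltr_pdivrMr.
Qed.

Lemma cell_sub_eball (R : realType) (n : nat) (s : R) (m : 'rV[int]_n) (x : 'rV[R]_n) :
  (0 < s)%R -> cell s m x -> cell s m `<=` eball x (n%:R * s).
Proof.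
move=> s0 xm y ym; apply: enorm_le_coord; first exact: ltW.
move=> i; rewrite !mxE.
have /andP[x1 x2] := cell_bounds i s0 xm; have /andP[y1 y2] := cell_bounds i s0 ym.
by rewrite ler_norml; lra.
Qed.

(** Two points whose coordinates differ by at most [n s] lie in cubes whose
    indices differ by at most [n] in each coordinate. *)
Lemma eball_sub_cells (R : realType) (n : nat) (s : R) (m : 'rV[int]_n)
    (x : 'rV[R]_n) :
  (0 < s)%R -> cell s m x ->
  eball x (n%:R * s) `<=`
  \big[setU/set0]_(v : {ffun 'I_n -> 'I_n.*2.+1}) cell s (m + box_vec v)%R.
Proof.
move=> s0 xm y xy.
pose w : 'rV[int]_n := (\row_i (Num.floor (y ord0 i / s) - m ord0 i))%R.
have [v vw] : exists v : {ffun 'I_n -> 'I_n.*2.+1}, box_vec v = w.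
  apply: box_vec_onto => i; rewrite mxE.
  have := le_trans (coord_le_enorm (y - x)%R i) xy.
  rewrite !mxE ler_norml => /andP[xy1 xy2].
  have /andP[x1 x2] := cell_bounds i s0 xm.
  have lo : (m ord0 i - n%:Z <= Num.floor (y ord0 i / s))%R.
    by rewrite floor_ge_int intrB ler_pdivlMr// mulrBl -pmulrn; lra.
  have hi : (Num.floor (y ord0 i / s) < m ord0 i + n%:Z + 1)%R.
    by rewrite floor_lt_int !intrD ltr_pdivrMr// -pmulrn; lra.
  by lia.
rewrite -bigcup_seq; exists v; first exact: mem_index_enum.
by move=> i; rewrite vw !mxE addrC subrK.
Qed.

Lemma near_cell_sub_ball (R : realType) (n : nat) (s : R) (m : 'rV[int]_n)
    (x : 'rV[R]_n) (v : {ffun 'I_n -> 'I_n.*2.+1}) :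
  (0 < s)%R -> cell s m x ->
  cell s (m + box_vec v)%R `<=` ball x (n.+1%:R * s)%R.
Proof.
move=> s0 xm y ym; split; first by rewrite mulr_gt0.
move=> i0 i; rewrite [i0]ord1 /ball/= -[(0 : 'I_1)%R]/ord0.
have /andP[x1 x2] := cell_bounds i s0 xm; have /andP[y1 y2] := cell_bounds i s0 ym.
move: y1 y2; rewrite !mxE => y1 y2.
have vn : (v i <= n.*2)%N by rewrite -ltnS.
have v1 : (- n%:R <= ((v i)%:Z - n%:Z)%:~R :> R)%R.
  by rewrite intrB -!pmulrn lerBrDl subrr.
have v2 : (((v i)%:Z - n%:Z)%:~R <= n%:R :> R)%R.
  rewrite intrB -!pmulrn lerBlDr -natrD ler_nat; lia.
move: y1 y2; rewrite intrD; set d := _%:~R in v1 v2 *.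
have d1 : (d * s <= n%:R * s)%R by rewrite ler_wpM2r// ltW.
have d2 : (- n%:R * s <= d * s)%R by rewrite ler_wpM2r// ltW.
by rewrite ltr_norml -natr1; nra.
Qed.

(** * Tilted points *)

(** Lists the cubes along an enumeration of the index vectors; the shift [u] is
    applied after the enumeration, so that for fixed [k] the sets obtained for
    varying [u] are neighbours of one another. *)
Definition shifted_cell (R : realType) (n : nat) (s : R) (u : 'rV[int]_n) (k : nat) :
    set 'rV[R]_n :=
  if pickle_inv k is Some m then cell s (m + u)%R else set0.

Lemma sum_shifted_cell_le (R : realType) (n : nat)
    (mu : {outer_measure set 'rV[R]_n -> \bar R}) (U : set 'rV[R]_n) (s : R)
    (u : 'rV[int]_n) :
  (forall W, open W -> mu.-caratheodory W) -> (0 < s)%R ->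
  \sum_(k <oo) mu (U `&` shifted_cell s u k) <= mu U.
Proof.
move=> mo s0.
have mcell k : mu.-caratheodory (shifted_cell s u k).
  rewrite /shifted_cell; case: pickle_inv => [m|]; first exact: caratheodory_cell.
  exact: caratheodory_measurable_set0.
have disj : trivIset setT (shifted_cell s u).
  move=> k l _ _ [x []]; rewrite /shifted_cell.
  have := @pickle_invK 'rV[int]_n k; have := @pickle_invK 'rV[int]_n l.
  case: (pickle_inv l) => [m' /= <-|//]; case: (pickle_inv k) => [m /= <-|//] xm xm'.
  congr pickle; apply: (addIr u); apply/rowP => i.
  exact: etrans (esym (xm i)) (xm' i).
apply: le_trans (caratheodory_lime_le mcell disj U).
by rewrite leeDl// outer_measure_ge0.
Qed.

Lemma bigcup_shifted_cell0 (R : realType) (n : nat) (s : R) :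
  \bigcup_k shifted_cell s (0 : 'rV[int]_n)%R k = [set: 'rV[R]_n].
Proof.
apply/seteqP; split=> // x _.
exists (pickle (\row_i Num.floor (x ord0 i / s)%R : 'rV[int]_n)) => //.
by rewrite /shifted_cell pickleK_inv addr0 => i; rewrite mxE.
Qed.

(** The points whose ball of radius [r] has nearly all its mass in some cone. The
    inequality is not written as a quotient, so that it also makes sense at
    points whose ball is null. *)
Definition tilted (R : realType) (n : nat)
    (mu : {outer_measure set 'rV[R]_n -> \bar R}) (alpha c r : R) : set 'rV[R]_n :=
  [set x | exists2 theta, esphere theta &
     mu (eball x r `\` cone x theta alpha) <= c%:E * mu (eball x r)].

(** Each point of [A] in the cube is low for one of the finitely many integer
    directions, relative to the mass [c] times the sum over the surrounding
    cubes, which bounds [c] times the mass of the ball around the point. *)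
Lemma tilted_cell_le (R : realType) (n K : nat) (alpha c s : R)
    (mu : {outer_measure set 'rV[R]_n -> \bar R}) (A : set 'rV[R]_n)
    (m : 'rV[int]_n) :
  (forall W, open W -> mu.-caratheodory W) -> (0 < s)%R -> (0 <= c)%R ->
  (n%:R <= alpha * K%:R)%R -> (0 < alpha)%R -> (0 < K)%N ->
  A `<=` tilted mu alpha c (n%:R * s) ->
  mu (A `&` cell s m) <=
  (#|{ffun 'I_n -> 'I_K.*2.+1}|%:R * c)%:E *
  \sum_(v : {ffun 'I_n -> 'I_n.*2.+1}) mu (cell s (m + box_vec v)%R).
Proof.
move=> mo s0 c0 aK a0 K0 At.
set S := (\sum_v _)%R; set Q := cell s m.
have S0 : 0 <= S by apply: sume_ge0 => v _; exact: outer_measure_ge0.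
pose dir (w : {ffun 'I_n -> 'I_K.*2.+1}) : 'rV[R]_n := map_mx intr (box_vec w).
pose low w := [set x | Q x /\
  mu (Q `&` [set y | (dot y (dir w) <= dot x (dir w))%R]) <= c%:E * S].
have cover : A `&` Q `<=` \big[setU/set0]_w low w.
  move=> x [Ax Qx]; have [theta th tx] := At x Ax.
  have [w cw] := cone_sub_integer_halfspace th aK a0 K0.
  rewrite -bigcup_seq; exists w; first exact: mem_index_enum.
  split=> //.
  apply: (@le_trans _ _ (mu (eball x (n%:R * s) `\` cone x theta alpha))).
    apply: le_outer_measure => y [Qy yx]; split.
      exact: (cell_sub_eball s0 Qx).
    by move=> /cw; rewrite ltNge; apply/negP; rewrite negbK.
  apply: le_trans tx _; apply: lee_wpmul2l; first by rewrite lee_fin.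
  apply: le_trans (le_outer_measure mu _ _ (eball_sub_cells s0 Qx)) _.
  exact: outer_measure_finU.
apply: le_trans (le_outer_measure mu _ _ cover) _.
apply: le_trans (outer_measure_finU _ _) _.
apply: (@le_trans _ _ (\sum_(w : {ffun 'I_n -> 'I_K.*2.+1}) c%:E * S)).
  apply: lee_sum => w _; apply: low_sublevel_small; last by rewrite mule_ge0.
  move=> t; apply: caratheodory_measurable_setI; first exact: caratheodory_cell.
  exact: caratheodory_dot_le.
by rewrite sumr_const EFinM -muleA mule_natl.
Qed.

(** A cube that meets the core of [U] has all its neighbours inside [U]. Summing
    [tilted_cell_le] over the grid and exchanging the sums, each of the offsets
    contributes at most [mu U], because a translated grid is still a partition. *)
Lemma tilted_core_le (R : realType) (n K : nat) (alpha c s : R)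
    (mu : {outer_measure set 'rV[R]_n -> \bar R}) (A U : set 'rV[R]_n) :
  (forall W, open W -> mu.-caratheodory W) -> (0 < s)%R -> (0 <= c)%R ->
  (n%:R <= alpha * K%:R)%R -> (0 < alpha)%R -> (0 < K)%N ->
  A `<=` tilted mu alpha c (n%:R * s) ->
  mu (A `&` core_set U (n.+1%:R * s)) <=
  (#|{ffun 'I_n -> 'I_K.*2.+1}|%:R * c * #|{ffun 'I_n -> 'I_n.*2.+1}|%:R)%:E * mu U.
Proof.
move=> mo s0 c0 aK a0 K0 At.
set N := #|{ffun 'I_n -> 'I_K.*2.+1}|; set B := A `&` _.
have Nc0 : (0 <= N%:R * c)%R by rewrite mulr_ge0.
have cellwise k : mu (B `&` shifted_cell s 0%R k) <= (N%:R * c)%:E *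
    \sum_(v : {ffun 'I_n -> 'I_n.*2.+1}) mu (U `&` shifted_cell s (box_vec v) k).
  have rhs0 : 0 <= (N%:R * c)%:E *
      \sum_(v : {ffun 'I_n -> 'I_n.*2.+1}) mu (U `&` shifted_cell s (box_vec v) k).
    by rewrite mule_ge0//; apply: sume_ge0 => v _; exact: outer_measure_ge0.
  have [->|/set0P[x [[Ax Ux]]]] := eqVneq (B `&` shifted_cell s 0%R k) set0.
    by rewrite outer_measure0.
  rewrite /shifted_cell in rhs0 *; case: (pickle_inv k) rhs0 => [m rhs0|//].
  rewrite addr0 => xm.
  have -> : \sum_(v : {ffun 'I_n -> 'I_n.*2.+1}) mu (U `&` cell s (m + box_vec v)%R) =
      \sum_(v : {ffun 'I_n -> 'I_n.*2.+1}) mu (cell s (m + box_vec v)%R).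
    apply: eq_bigr => v _; congr (mu _); apply: setIidr.
    exact: subset_trans (near_cell_sub_ball s0 xm) Ux.
  apply: (tilted_cell_le _ mo s0 c0 aK a0 K0).
  by apply: subset_trans At; exact: subIsetl.
have -> : B = B `&` \bigcup_k shifted_cell s 0%R k by rewrite bigcup_shifted_cell0 setIT.
apply: le_trans (outer_measure_bigcup_lim _ _ _) _.
apply: le_trans (lee_nneseries (fun k _ _ => outer_measure_ge0 mu _)
  (fun k _ => cellwise k)) _.
rewrite nneseriesZl; last by move=> k _; apply: sume_ge0 => v _; exact: outer_measure_ge0.
rewrite nneseries_sum; last by move=> *; exact: outer_measure_ge0.
rewrite [in leRHS]EFinM -muleA; apply: lee_wpmul2l; first by rewrite lee_fin.
apply: (@le_trans _ _ (\sum_(v : {ffun 'I_n -> 'I_n.*2.+1}) mu U)).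
  by apply: lee_sum => v _; exact: sum_shifted_cell_le.
by rewrite sumr_const mule_natl.
Qed.

(** Letting the mesh tend to 0 gives [mu A <= mu U / 2] for every open [U]
    containing [A], hence [mu A <= mu A / 2] by outer regularity. *)
Lemma uniformly_tilted_null (R : realType) (n K : nat) (alpha c r0 : R)
    (mu : {outer_measure set 'rV[R]_n -> \bar R}) (A : set 'rV[R]_n) :
  borel_regular mu -> mu setT < +oo -> (0 <= c)%R ->
  (#|{ffun 'I_n -> 'I_K.*2.+1}|%:R * c * #|{ffun 'I_n -> 'I_n.*2.+1}|%:R <= 2^-1)%R ->
  (n%:R <= alpha * K%:R)%R -> (0 < alpha)%R -> (0 < K)%N -> (0 < n)%N -> (0 < r0)%R ->
  (forall r, (0 < r)%R -> (r < r0)%R -> A `<=` tilted mu alpha c r) -> mu A = 0.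
Proof.
move=> [mb hull] mufin c0 Nc aK a0 K0 n0 r00 At.
have mo W : open W -> mu.-caratheodory W by move=> oW; apply: mb; exact: sub_sigma_algebra.
have fin X : mu X \is a fin_num.
  rewrite ge0_fin_numE ?outer_measure_ge0//; apply: le_lt_trans mufin.
  exact: le_outer_measure.
have half U : open U -> A `<=` U -> mu A <= (2^-1)%:E * mu U.
  move=> oU AU; apply/lee_addgt0Pr => e e0.
  have [rho rho0 Hrho] := core_set_exhausts mo mufin oU e0.
  (* The mesh: neighbouring cubes stay within [rho], the balls of radius [n s]
     are admissible. *)
  pose s := (Num.min rho (r0 / 2) / n.+1%:R)%R.
  have min0 : (0 < Num.min rho (r0 / 2))%R by rewrite lt_min rho0 divr_gt0.
  have s0 : (0 < s)%R by rewrite divr_gt0.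
  have sn : (n.+1%:R * s = Num.min rho (r0 / 2))%R by rewrite mulrC divfK.
  have srho : (n.+1%:R * s <= rho)%R by rewrite sn ge_min lexx.
  have sr0 : (n%:R * s < r0)%R.
    apply: (@le_lt_trans _ _ (n.+1%:R * s)%R).
      by rewrite ler_wpM2r ?ler_nat// ltW.
    by rewrite sn gt_min; apply/orP; right; lra.
  have sub : A `<=` (A `&` core_set U (n.+1%:R * s)) `|` (U `\` core_set U rho).
    move=> x Ax; have [cx|cx] := pselect (core_set U rho x).
      by left; split=> //; exact: core_set_le cx.
    by right; split=> //; exact: AU.
  apply: le_trans (le_outer_measure mu _ _ sub) _.
  apply: le_trans (outer_measureU2 _ _ _) _; apply: leeD; last exact: ltW.
  apply: le_trans (tilted_core_le _ mo s0 c0 aK a0 K0 _) _.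
    by apply: At => //; rewrite mulr_gt0// ltr0n.
  by apply: lee_wpmul2r; [exact: outer_measure_ge0|rewrite lee_fin].
have {}half : mu A <= (2^-1)%:E * mu A.
  apply/lee_addgt0Pr => e e0.
  have [U [oU AU UA]] := outer_regular mo mufin (hull A) e0.
  apply: le_trans (half U oU AU) _.
  apply: le_trans (lee_wpmul2l _ UA) _; first by rewrite lee_fin.
  rewrite -(fineK (fin A)) -EFinD -!EFinM -EFinD lee_fin; lra.
apply/eqP; rewrite eq_le outer_measure_ge0 andbT.
by move: half; rewrite -(fineK (fin A)) -EFinM !lee_fin; lra.
Qed.

(** Valid for a null denominator too: then [a = 0] as well. *)
Lemma ratio_lt_le (R : realType) (a b : \bar R) (c : R) :
  0 <= a -> a <= b -> b < +oo -> a / b < c%:E -> a <= c%:E * b.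
Proof.
move=> a0 ab boo abc; have b0 := le_trans a0 ab.
have [bz|bn] := eqVneq b 0; first by move: ab; rewrite bz mule0.
move: b b0 boo bn ab abc => [b| |]// b0 _ bn _.
have bpos : (0 < b)%R by rewrite lt_neqAle eq_sym bn.
by rewrite inver gt_eqF// lte_pdivrMr// => /ltW.
Qed.

Lemma tilted_of_limsup_lt (R : realType) (n : nat) (alpha c : R)
    (mu : {outer_measure set 'rV[R]_n -> \bar R}) (x : 'rV[R]_n) :
  mu setT < +oo ->
  limf_esup (fun r : R => ereal_inf
     [set mu (eball x r `\` cone x theta alpha) / mu (eball x r)
     | theta in esphere]) 0^'+ < c%:E ->
  exists2 r0 : R, (0 < r0)%R &
    forall r, (0 < r)%R -> (r < r0)%R -> tilted mu alpha c r x.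
Proof.
move=> mufin /ereal_inf_lt[_ [V V0 <-] supV].
have /nbhs_ballP[e /= e0 eV] := V0.
exists e => // r r0 re.
have Vr : V r by apply: eV => //; rewrite /ball/= sub0r normrN gtr0_norm.
have : ereal_inf [set mu (eball x r `\` cone x theta alpha) / mu (eball x r)
     | theta in esphere] < c%:E.
  by apply: le_lt_trans supV; apply: ereal_sup_ubound; exists r.
move=> /ereal_inf_lt[_ [theta th <-] lt]; exists theta => //.
apply: ratio_lt_le lt; first exact: outer_measure_ge0.
  by apply: le_outer_measure; exact: subDsetl.
by apply: le_lt_trans mufin; exact: le_outer_measure.
Qed.


(** * The conical density theorem *)

Unset Implicit Arguments.

Theorem theorem3p1 (R : realType) (n : nat) (alpha : R)
    (hn : (0 < n)%N) (halpha0 : (0 < alpha)%R) (halpha1 : (alpha <= 1)%R) :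
  exists2 c : R, (0 < c)%R &
    forall mu : {outer_measure set 'rV[R]_n -> \bar R},
      borel_regular mu -> mu setT < +oo -> mu setT != 0 ->
      outer_ae mu (fun x : 'rV[R]_n =>
        c%:E < limf_esup
          (fun r : R => ereal_inf
             [set mu (eball x r `\` cone x theta alpha) / mu (eball x r)
             | theta in esphere])
          0^'+).
Proof.
have na0 : (0 <= n%:R / alpha)%R by rewrite divr_ge0// ltW.
have := archi_boundP na0; set K := Num.bound _ => Kbig.
have K0 : (0 < K)%N by rewrite -(ltr_nat R); exact: le_lt_trans Kbig.
have aK : (n%:R <= alpha * K%:R)%R by rewrite mulrC -ler_pdivrMr// ltW.
pose N : R := #|{ffun 'I_n -> 'I_K.*2.+1}|%:R.
pose D : R := #|{ffun 'I_n -> 'I_n.*2.+1}|%:R.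
have N0 : (0 < N)%R by rewrite ltr0n card_ffun card_ord expn_gt0.
have D0 : (0 < D)%R by rewrite ltr0n card_ffun card_ord expn_gt0.
pose c := ((2 * N * D)^-1)%R.
have c0 : (0 < c)%R by rewrite invr_gt0 !mulr_gt0.
have Nc : (N * c * D <= 2^-1)%R.
  rewrite le_eqVlt; apply/orP; left; apply/eqP; rewrite /c; field.
  by rewrite !gt_eqF.
(* Halving [c] leaves room to turn the failure of a strict inequality for the
   limsup into a strict upper bound. *)
exists (c / 2)%R; first by rewrite divr_gt0.
move=> mu regmu mufin _; rewrite /outer_ae.
(* The threshold radius depends on the point; countably many of them suffice. *)
pose A j := [set x | forall r, (0 < r)%R -> (r < j.+1%:R^-1)%R -> tilted mu alpha c r x].
have A0 j : mu (A j) = 0.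
  have j0 : (0 < j.+1%:R^-1 :> R)%R by rewrite invr_gt0.
  apply: (uniformly_tilted_null regmu mufin (ltW c0) Nc aK halpha0 K0 hn j0).
  by move=> r r0 rj x; apply.
apply/eqP; rewrite eq_le outer_measure_ge0 andbT.
apply: (@le_trans _ _ (mu (\bigcup_j A j))).
  apply: le_outer_measure => x /= /negP; rewrite -leNgt => limle.
  have limlt : limf_esup (fun r : R => ereal_inf
     [set mu (eball x r `\` cone x theta alpha) / mu (eball x r)
     | theta in esphere]) 0^'+ < c%:E.
    by apply: le_lt_trans limle _; rewrite lte_fin; lra.
  have [r0 r00 tx] := tilted_of_limsup_lt mufin limlt.
  have [j _ /(_ j (leqnn j)) jr0] := near_infty_natSinv_lt (PosNum r00).
  by exists j => // r rpos rj; apply: tx => //; exact: lt_trans rj jr0.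
apply: le_trans (outer_measure_sigma_subadditive mu _) _.
by rewrite eseries0.
Qed.
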